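(* Let $\bar N$ be an $n$-dimensional Riemannian manifold and consider the product Riemannian manifold $\bar N\times\mathbb{R}^s$, $s>1$, with the product metric. Then every compact subset $K\subset\bar N\times\mathbb{R}^s$ contains no non-zero $(n+k)$-varifold with null first variation relative to $\bar N\times\mathbb{R}^s$, for every $k=1,\dots,s-1$.
   Context: Let $(Z,h)$ be a Riemannian manifold of dimension $z$, isometrically embedded in some Euclidean space $\mathbb{R}^L$, and $K\subset Z$. For $1\le j\le z$, a $j$-varifold in $K$ is a Radon measure $V$ on $G_j(K)=\{(x,P):x\in K,\ P \text{ a } j\text{-dimensional linear subspace of } T_xZ\}$ (planes identified with their orthogonal projection matrices in $\mathbb{R}^L$). $V$ has null first variation relative to $Z$ (is stationary in $Z$) if $\int_{G_j(K)}\operatorname{div}_PX(x)\,dV(x,P)=0$ for every compactly supported $C^1$ vector field $X$ on $Z$ tangent to $Z$, where $\operatorname{div}_PX=\sum_{i,l}P_{il}\partial_lX^i$ (with $X$ extended to a neighborhood in $\mathbb{R}^L$). *)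

(* Defs.v *)
From HB Require Import structures.
From mathcomp Require Import all_boot all_order all_algebra.
From mathcomp Require Import all_classical all_reals all_analysis.
Set Implicit Arguments. Unset Strict Implicit. Unset Printing Implicit Defensive.
Import Order.TTheory GRing.Theory Num.Theory.
Import numFieldNormedType.Exports.
Local Open Scope classical_set_scope.
Local Open Scope ring_scope.

Definition ebasis (R : realType) (M : nat) (i : 'I_M) : 'rV[R]_M := delta_mx 0 i.

Definition pder (R : realType) (M m : nat) (F : 'rV[R]_M -> 'rV[R]_m) (l : 'I_M)
  (x : 'rV[R]_M) : 'rV[R]_m := derive F x (ebasis R l).

Fixpoint Ck (R : realType) (M m : nat) (k : nat) (F : 'rV[R]_M -> 'rV[R]_m) : Prop :=
  match k with
  | 0 => continuous F
  | k'.+1 => continuous F /\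
      forall l : 'I_M, (forall x, derivable F x (ebasis R l)) /\ Ck k' (pder F l)
  end.

Definition smooth (R : realType) (M m : nat) (F : 'rV[R]_M -> 'rV[R]_m) : Prop :=
  forall k, Ck k F.

Definition jacobian (R : realType) (M m : nat) (F : 'rV[R]_M -> 'rV[R]_m)
  (x : 'rV[R]_M) : 'M[R]_(M, m) := \matrix_(l < M, i < m) pder F l x 0 i.

Definition submanifold (R : realType) (L n : nat) (N : set 'rV[R]_L) : Prop :=
  (n <= L)%N /\
  forall p, N p -> exists U : set 'rV[R]_L, open U /\ U p /\
    exists F : 'rV[R]_L -> 'rV[R]_(L - n), smooth F /\
      (forall x, U x -> (N x <-> F x = 0)) /\
      (forall x, U x -> N x -> \rank (jacobian F x) = (L - n)%N).

Definition tangent (R : realType) (M : nat) (Z : set 'rV[R]_M) (x : 'rV[R]_M)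
  (v : 'rV[R]_M) : Prop :=
  exists g : R -> 'rV[R]_M, g 0 = x /\ (\forall t \near (0:R), Z (g t)) /\
    derivable g 0 1 /\ derive g 0 1 = v.

Definition prodZ (R : realType) (L s : nat) (N : set 'rV[R]_L) : set 'rV[R]_(L + s) :=
  [set z | exists x y, N x /\ z = row_mx x y].

Definition GSpace (R : realType) (M : nat) := ('rV[R]_M * 'M[R]_M)%type.

Definition GBorel (R : realType) (M : nat) :=
  g_sigma_algebraType (@open (GSpace R M)).

(* G_j(K): x in K, P the orthogonal projection onto a j-dim subspace of T_x Z *)
Definition Grass (R : realType) (M : nat) (Z : set 'rV[R]_M) (j : nat)
  (K : set 'rV[R]_M) : set (GSpace R M) :=
  [set xP | K xP.1 /\ xP.2^T = xP.2 /\ xP.2 *m xP.2 = xP.2 /\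
            \rank xP.2 = j /\ forall v, tangent Z xP.1 (v *m xP.2)].

(* j-varifold in K: a Radon (i.e. finite Borel, as G_j(K) is compact) measure
   on G_j(K), represented as a Borel measure on the ambient space vanishing
   outside G_j(K). *)
Definition varifold (R : realType) (M : nat) (Z : set 'rV[R]_M) (j : nat)
  (K : set 'rV[R]_M) (V : {measure set (GBorel R M) -> \bar R}) : Prop :=
  (V setT < +oo)%E /\ V (~` Grass Z j K) = 0%E.

Definition divP (R : realType) (M : nat) (P : 'M[R]_M) (X : 'rV[R]_M -> 'rV[R]_M)
  (x : 'rV[R]_M) : R :=
  \sum_(i < M) \sum_(l < M) P i l * pder X l x 0 i.

Definition tangent_field (R : realType) (M : nat) (Z : set 'rV[R]_M)
  (X : 'rV[R]_M -> 'rV[R]_M) : Prop :=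
  Ck 1 X /\ (exists C : set 'rV[R]_M, compact C /\ forall x, ~ C x -> X x = 0) /\
  forall x, Z x -> tangent Z x (X x).

Definition stationary (R : realType) (M : nat) (Z : set 'rV[R]_M)
  (V : {measure set (GBorel R M) -> \bar R}) : Prop :=
  forall X, tangent_field Z X ->
    (\int[V]_(xP in setT) (divP (xP : GSpace R M).2 X xP.1)%:E = 0)%E.

(* Main.v *)
Require Import Defs.
From HB Require Import structures.
From mathcomp Require Import all_boot all_order all_algebra.
From mathcomp Require Import all_classical all_reals all_analysis.
From mathcomp Require Import measurable_realfun ring lra.
Import Order.TTheory GRing.Theory Num.Theory.
Import numFieldNormedType.Exports.
Local Open Scope classical_set_scope.
Local Open Scope ring_scope.

Set Implicit Arguments.
Unset Strict Implicit.
Unset Printing Implicit Defensive.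

(** Test stationarity against [X(x, y) = chi(|(x, y)|^2) (0, y)], where the cutoff
    [chi] equals 1 on [K].  This field is tangent to [N x R^s], and over [K] its
    divergence along a plane [P] is the trace of [P] on the factor [R^s], i.e.
    [tr P] minus the trace of the [R^L]-block.  Since [P] lies in
    [T_x N x R^s] and [dim T_x N = n], that block has trace at most [n], so the
    divergence is at least [(n + k) - n = k > 0] on the whole of [G_{n+k}(K)] and
    the integral can only vanish if [V] does.

    As [V] is only constrained on Borel sets, [V (~` G) = 0] carries information
    only once [G = G_{n+k}(K)] is known to be Borel.  It is closed: by the implicit
    function theorem the tangent vectors of [N] are exactly the kernel of the
    Jacobian of a local defining function, which depends continuously on the
    point. *)

(** * Traces of orthogonal projections *)

Lemma mxtrace_gram_ge0 (R : realFieldType) (m p : nat) (M : 'M[R]_(m, p)) :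
  0 <= \tr (M^T *m M).
Proof.
rewrite /mxtrace; apply: sumr_ge0 => i _; rewrite mxE.
by apply: sumr_ge0 => j _; rewrite mxE -expr2 sqr_ge0.
Qed.

Lemma gram_row_eq0 (R : realFieldType) (p : nat) (w : 'rV[R]_p) :
  w *m w^T = 0 -> w = 0.
Proof.
move=> /matrixP/(_ 0 0); rewrite !mxE => /eqP.
rewrite psumr_eq0; last by move=> i _; rewrite mxE -expr2 sqr_ge0.
move=> /allP w0; apply/rowP => i; have := w0 i (mem_index_enum _).
by rewrite mxE -expr2 sqrf_eq0 mxE => /eqP.
Qed.

(** If [v J^T J = 0], then [v J^T] has zero Euclidean square and so vanishes; full column rank of
    [J] makes [v |-> v J^T] injective. *)
Lemma gram_unitmx (R : realFieldType) (m p : nat) (J : 'M[R]_(p, m)) :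
  \rank J = m -> J^T *m J \in unitmx.
Proof.
move=> rJ; rewrite -row_free_unit -kermx_eq0; apply/rowV0P => v.
move=> /sub_kermxP vJJ.
have /gram_row_eq0 vJ : (v *m J^T) *m (v *m J^T)^T = 0.
  by rewrite trmx_mul trmxK mulmxA -[_ *m J]mulmxA vJJ mul0mx.
have Jfree : row_free J^T by rewrite /row_free mxrank_tr rJ.
by apply/eqP; rewrite -(mulmx_free_eq0 _ Jfree) vJ.
Qed.

(** In a rank factorization [P = C E], [C] is left-invertible and [E] right-invertible. Cancelling
    them in [C E C E = C E] leaves [E C = 1], of size [\rank P], and the trace is cyclic. *)
Lemma mxtrace_idem (F : fieldType) (m : nat) (P : 'M[F]_m) :
  P *m P = P -> \tr P = (\rank P)%:R.
Proof.
move=> PP.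
have [B BC] := row_fullP (col_base_full P).
have [D RD] := row_freeP (row_base_free P).
move: (col_base P) (row_base P) (mulmx_base P) BC RD => C E CE BC RD.
suff EC : E *m C = 1%:M by rewrite -{1}CE mxtrace_mulC EC mxtrace1.
have CECE : C *m (E *m C) *m E = C *m E by rewrite mulmxA CE -mulmxA CE PP.
have := congr1 (fun S => B *m S *m D) CECE.
by rewrite /= !mulmxA BC !mul1mx -!mulmxA RD mulmx1.
Qed.

(* With [Q := 1 - J (J^T J)^-1 J^T] the orthogonal projection onto the kernel of
   [v |-> v J], one has [tr Q - tr (ulsubmx P) = tr (Q ((1 - P)^T (1 - P))_ul Q)],
   the trace of a Gram matrix. *)
Lemma mxtrace_ulsubmx_le (R : realFieldType) (L s n : nat)
    (P : 'M[R]_(L + s)) (J : 'M[R]_(L, L - n)) :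
  (n <= L)%N -> P^T = P -> P *m P = P -> \rank J = (L - n)%N ->
  lsubmx P *m J = 0 -> \tr (ulsubmx P) <= n%:R.
Proof.
move=> nL PT PP rJ AJ.
set A := lsubmx P in AJ *.
have U := gram_unitmx rJ.
pose Q := 1%:M - J *m invmx (J^T *m J) *m J^T.
have QT : Q^T = Q.
  rewrite /Q linearB /= trmx1 !trmx_mul trmxK trmx_inv trmx_mul trmxK.
  by rewrite mulmxA.
have AQ : A *m Q = A by rewrite /Q mulmxBr mulmx1 !mulmxA AJ !mul0mx subr0.
have trQ : \tr Q = n%:R.
  rewrite /Q linearB /= mxtrace1 -mulmxA mxtrace_mulC -mulmxA mulVmx // mxtrace1.
  by rewrite natrB // opprB addrC subrK.
have QQ : Q *m Q = Q.
  rewrite {1}/Q mulmxBl mul1mx {1}/Q mulmxBr mulmx1 !mulmxA.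
  by rewrite -(mulmxA _ J^T J) mulmxKV // subrr subr0.
(* An orthogonal projection satisfies [S = S^T S], so its upper left block is the Gram matrix of its
   first [L] columns. *)
have gram (S : 'M[R]_(L + s)) : S^T = S -> S *m S = S ->
    ulsubmx S = (lsubmx S)^T *m lsubmx S.
  move=> ST SS.
  have : S^T *m S = S by rewrite ST.
  rewrite -{1 2}(hsubmxK S) tr_row_mx mul_col_row => {1}<-.
  by rewrite block_mxKul.
clearbody Q.
rewrite -subr_ge0 -trQ.
have Pc : (1%:M - P)^T = 1%:M - P by rewrite linearB /= trmx1 PT.
have PPc : (1%:M - P) *m (1%:M - P) = 1%:M - P.
  by rewrite mulmxBl mul1mx mulmxBr mulmx1 PP subrr subr0.
have -> : \tr Q - \tr (ulsubmx P) =
    \tr ((lsubmx (1%:M - P) *m Q)^T *m (lsubmx (1%:M - P) *m Q)).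
  rewrite trmx_mul QT mulmxA -(mulmxA Q) -gram //.
  have -> : ulsubmx (1%:M - P) = 1%:M - ulsubmx P.
    by rewrite /ulsubmx /= !linearB /= -/(ulsubmx 1%:M) scalar_mx_block block_mxKul.
  rewrite mulmxBr mulmx1 mulmxBl QQ linearB /= gram //; congr (_ - \tr _).
  (* [A Q = A] and its transpose absorb both factors [Q] around [A^T A]. *)
  by rewrite -/A -[in LHS]AQ trmx_mul QT !mulmxA -!mulmxA AQ.
exact: mxtrace_gram_ge0.
Qed.

(** * Strict differentiability of C^1 maps *)

Lemma coef_le_norm (R : realType) m n (M : 'M[R]_(m, n)) i j : `|M i j| <= `|M|.
Proof.
by rewrite [leRHS]/Num.Def.normr/= mx_normrE; exact: (le_bigmax _ _ (i, j)).
Qed.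

Lemma norm_mx_le (R : realType) m n (M : 'M[R]_(m, n)) (e : R) :
  0 <= e -> (forall i j, `|M i j| <= e) -> `|M| <= e.
Proof.
move=> e0 Me; rewrite [leLHS]/Num.Def.normr/= mx_normrE.
by rewrite (bigmax_le _ e0)//= => -[i j] _.
Qed.

Lemma norm_mx_lt (R : realType) m n (M : 'M[R]_(m, n)) (e : R) :
  0 < e -> (forall i j, `|M i j| < e) -> `|M| < e.
Proof.
move=> e0 Me; rewrite [ltLHS]/Num.Def.normr/= mx_normrE.
by apply/bigmax_ltP; split => // -[i j].
Qed.

Lemma is_derive_line (R : realType) (V W : normedModType R) (f : V -> W)
    (x v : V) (t : R) (df : W) :
  is_derive (x + t *: v) v f df ->
  is_derive t 1 (fun t => f (x + t *: v)) df.
Proof.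
have E : (fun h => h^-1 *: (((fun t => f (x + t *: v)) \o shift t) (h *: (1:R))
            - f (x + t *: v))) =
         (fun h => h^-1 *: ((f \o shift (x + t *: v)) (h *: v) - f (x + t *: v))).
  apply/funext => h /=; congr (_ *: (f _ - _)).
  by rewrite [_ *: 1]mulr1 scalerDl addrCA.
by case=> dv dE; split; rewrite /derivable /derive E.
Qed.

Lemma MVT_line (R : realType) (V : normedModType R) (f : V -> R)
    (x v : V) (c : R) :
  (forall y, derivable f y v) ->
  exists2 u, 0 <= u <= 1 &
    f (x + c *: v) - f x = 'D_v f (x + (u * c) *: v) * c.
Proof.
move=> df.
pose g (t : R) := f (x + t *: v).
have dg (t : R) : is_derive t (1 : R) g ('D_v f (x + t *: v)).
  by apply: is_derive_line; split.
(* Rescaling by [c] moves the problem to [[0, 1]] whatever the sign of [c]. *)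
pose h (u : R) := g (u * c).
have dh (u : R) : is_derive u (1 : R) h ('D_v f (x + (u * c) *: v) * c).
  have dm : is_derive u (1 : R) ( *%R^~ c : R -> R) c.
    have -> : ( *%R^~ c : R -> R) = c \*: id by apply/funext => y; exact: mulrC.
    by apply: is_derive_eq; rewrite [_ *: 1]mulr1.
  have := @is_derive1_comp R g ( *%R^~ c) u _ _ (dg _) dm.
  by move=> H; apply: is_derive_eq H _; rewrite /GRing.scale /= mulrC.
have hc : {within `[0, 1], continuous h}.
  apply: derivable_within_continuous => y _; exact: ex_derive.
have [u u01 hu] := MVT_segment ler01 (fun x _ => dh x) hc.
exists u; first by move: u01; rewrite in_itv.
by move: hu; rewrite /h /g mul1r mul0r scale0r addr0 subr0 mulr1.
Qed.

Definition mix_row (R : realType) (M : nat) (a b : 'rV[R]_M) (k : nat) : 'rV[R]_M :=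
  \row_i (if (i < k)%N then b 0 i else a 0 i).

Lemma mix_rowS (R : realType) (M : nat) (a b : 'rV[R]_M) (k : 'I_M) :
  mix_row a b k.+1 = mix_row a b k + (b 0 k - a 0 k) *: ebasis R k.
Proof.
apply/rowP => i; rewrite !mxE eqxx /= ltnS leq_eqVlt.
have [->|ik] := eqVneq i k; first by rewrite eqxx ltnn mulr1 addrC subrK.
by rewrite (negbTE (_ : (i : nat) != k)) //= mulr0 addr0.
Qed.

Lemma pder_coef (R : realType) (M m : nat) (F : 'rV[R]_M -> 'rV[R]_m) l x i :
  derivable F x (ebasis R l) ->
  pder F l x 0 i = 'D_(ebasis R l) (fun y => F y 0 i) x.
Proof. by move=> dF; rewrite /pder derive_mx // mxE. Qed.

(* Move from [a] to [b] one coordinate at a time: the balls of the sup norm are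
   cubes, so the path stays in the ball, and each step is a one-variable MVT. *)
Lemma Ck1_strict_diff (R : realType) (M m : nat) (F : 'rV[R]_M -> 'rV[R]_m)
    (x0 : 'rV[R]_M) (e : R) :
  Ck 1 F -> 0 < e ->
  exists2 d, 0 < d & forall a b, `|a - x0| < d -> `|b - x0| < d ->
    `|F b - F a - (b - a) *m Defs.jacobian F x0| <= e * `|b - a|.
Proof.
move=> [_ CF] e0.
have dF l x : derivable F x (ebasis R l) by case: (CF l).
(* Each of the [M] coordinate steps may cost [e' * |b - a|]; [M + 1] keeps the denominator nonzero
   when [M = 0]. *)
pose e' := e / M.+1%:R.
have e'0 : 0 < e' by rewrite divr_gt0.
have : \forall x \near x0, forall l, `|pder F l x0 - pder F l x| <= e'.
  apply: (@filter_forall _ _ (fun l x => `|pder F l x0 - pder F l x| <= e')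
    (nbhs x0) _) => l.
  by have [_ /(_ x0) /cvgrPdist_le] := CF l; apply.
move=> /nbhs_ballP[d /= d0 dP]; exists d => // a b ax bx.
apply: norm_mx_le; first by rewrite mulr_ge0 // ltW.
move=> i0 i; rewrite (ord1 i0) {i0}.
pose G y := F y 0 i.
have dG l y : derivable G y (ebasis R l).
  by have /derivable_mxP := dF l y; exact.
pose z := mix_row a b.
have za : z 0%N = a by apply/rowP => j; rewrite mxE.
have zb : z M = b by apply/rowP => j; rewrite mxE ltn_ord.
have step (k : 'I_M) :
    `|G (z k.+1) - G (z k) - (b 0 k - a 0 k) * Defs.jacobian F x0 k i|
    <= e' * `|b - a|.
  rewrite /z mix_rowS -/z.
  have [u u01 ->] := MVT_line (z k) (b 0 k - a 0 k) (dG k).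
  set y := z k + _.
  rewrite mulrC -mulrBr normrM mulrC ler_pM //; last first.
    by have := coef_le_norm (b - a) 0 k; rewrite !mxE.
  rewrite mxE /G -pder_coef //.
  (* The [k]-th coordinate of [y] is a convex combination of those of [a] and [b]; every other one
     is taken from [a] or from [b]. *)
  have /dP/(_ k) : ball x0 d y.
    rewrite -ball_normE /ball_ /=; apply: norm_mx_lt => // j0 j; rewrite (ord1 j0) {j0}.
    have := le_lt_trans (coef_le_norm (a - x0) 0 j) ax.
    have := le_lt_trans (coef_le_norm (b - x0) 0 j) bx.
    rewrite !mxE eqxx /= !ltr_norml.
    have [->|jk] := eqVneq j k.
      rewrite ltnn mulr1; move: u01 => /andP[u0 u1] /andP[? ?] /andP[? ?].
      have u1' : 0 <= 1 - u by rewrite subr_ge0.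
      have [ab|/ltW ab] := leP (a 0 k) (b 0 k); rewrite -subr_ge0 in ab.
        have := mulr_ge0 u0 ab; have := mulr_ge0 u1' ab.
        by move=> *; apply/andP; split; lra.
      have := mulr_ge0 u0 ab; have := mulr_ge0 u1' ab.
      by move=> *; apply/andP; split; lra.
    rewrite mulr0 addr0; case: ifP => _ /andP[? ?] /andP[? ?]; apply/andP; split; lra.
  move=> H; rewrite distrC; apply: le_trans H.
  by have := coef_le_norm (pder F k x0 - pder F k y) 0 i; rewrite !mxE.
(* The increments of [F] telescope along the path, and [(b - a) J] splits by coordinates. *)
have -> : (F b - F a - (b - a) *m Defs.jacobian F x0) 0 i =
    \sum_(k < M) (G (z k.+1) - G (z k) - (b 0 k - a 0 k) * Defs.jacobian F x0 k i).
  rewrite sumrB -(big_mkord xpredT (fun k => G (z k.+1) - G (z k))).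
  rewrite telescope_sumr // za zb !mxE; congr (_ - _).
  by apply: eq_bigr => k _; rewrite !mxE.
apply: le_trans (ler_norm_sum _ _ _) _.
apply: le_trans (ler_sum _ (fun k _ => step k)) _.
rewrite sumr_const card_ord -mulr_natr mulrAC ler_wpM2r //.
rewrite /e' mulrAC ler_pdivrMr // ler_pM2l // ler_nat; exact: leqnSn.
Qed.

(** * Tangent vectors of a regular zero set *)

(** The sup norm is not submultiplicative: summing over the [n] inner indices costs the factor
    [n]. *)
Lemma norm_mulmx_le (R : realType) m n p (A : 'M[R]_(m, n)) (B : 'M[R]_(n, p)) :
  `|A *m B| <= `|A| * (n%:R * `|B|).
Proof.
apply: norm_mx_le => [|i j]; first by rewrite !mulr_ge0.
rewrite mxE; apply: le_trans (ler_norm_sum _ _ _) _.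
have le1 k : `|A i k * B k j| <= `|A| * `|B|.
  by rewrite normrM ler_pM // coef_le_norm.
apply: le_trans (ler_sum _ (fun k _ => le1 k)) _.
by rewrite sumr_const card_ord -[leLHS]mulr_natl mulrCA lexx.
Qed.

(** Completeness of matrix spaces, for the contraction argument in [near_zero_regular]. *)
HB.instance Definition _ (R : realType) (m n : nat) := Complete.on 'M[R]_(m, n).

(* [T y := y - F (p + y D)] with [D] a one-sided inverse of the Jacobian is a
   1/2-contraction of the ball of radius [2 |F p|]. *)
Lemma near_zero_regular (R : realType) (L m : nat) (F : 'rV[R]_L -> 'rV[R]_m)
    (x : 'rV[R]_L) :
  Ck 1 F -> F x = 0 -> \rank (Defs.jacobian F x) = m ->
  exists2 c, 0 <= c & \forall p \near x,
    exists2 z, F z = 0 & `|z - p| <= c * `|F p|.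
Proof.
move=> CF Fx rJ.
have /row_fullP[D DJ] : row_full (Defs.jacobian F x) by rewrite /row_full rJ.
pose C := m%:R * `|D|.
have C0 : 0 <= C by rewrite mulr_ge0.
have C1 : 0 < C + 1 by rewrite ltr_wpDl.
(* Since [|y D| <= C |y|], this tolerance makes the linearization error along [D] at most [|y| / 2];
   [C + 1] is positive even if [D = 0]. *)
have e0 : 0 < ((C + 1) * 2)^-1 by rewrite invr_gt0 mulr_gt0.
have [d d0 dP] := Ck1_strict_diff x CF e0.
exists (C * 2); first by rewrite mulr_ge0.
(* Together with [|x - p| < d / 2], this keeps [p + y D] within [d] of [x] whenever
   [|y| <= 2 |F p|]. *)
have Fnear : \forall p \near x, `|F p| < d / 2 / (2 * (C + 1)).
  have [Fc _] := CF.
  have /cvgrPdist_lt/(_ (d / 2 / (2 * (C + 1)))) := Fc x.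
  rewrite !divr_gt0 ?mulr_gt0 // => /(_ isT); apply: filterS => p.
  by rewrite Fx sub0r normrN.
have xnear : \forall p \near x, `|x - p| < d / 2.
  have : x @[x --> x] --> x by exact: cvg_id.
  by move=> /cvgrPdist_lt; apply; rewrite divr_gt0.
near=> p.
pose r := 2 * `|F p|.
pose U := closed_ball_ Num.norm (0 : 'rV[R]_m) r.
have r0 : 0 <= r by rewrite mulr_ge0.
have UP y : U y <-> `|y| <= r by rewrite /U /closed_ball_ /= sub0r normrN.
have inb y : U y -> `|p + y *m D - x| < d.
  move=> /UP yr; rewrite addrAC.
  apply: le_lt_trans (ler_normD _ _) _; rewrite [ltRHS]splitr.
  apply: ltr_leD; first by rewrite distrC; near: p.
  apply: le_trans (norm_mulmx_le _ _) _; rewrite -/C.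
  apply: (@le_trans _ _ (r * (C + 1))); first by rewrite ler_pM // lerDl.
  have : `|F p| < d / 2 / (2 * (C + 1)) by near: p.
  by rewrite ltr_pdivlMr ?mulr_gt0 // mulrCA mulrA => /ltW.
pose T y := y - F (p + y *m D).
have Tlip y y' : U y -> U y' -> `|T y' - T y| <= 2^-1 * `|y' - y|.
  move=> Uy Uy'.
  have := dP _ _ (inb _ Uy) (inb _ Uy').
  have -> : p + y' *m D - (p + y *m D) = (y' - y) *m D.
    by rewrite opprD addrACA subrr add0r mulmxBl.
  rewrite -mulmxA DJ mulmx1.
  have -> : F (p + y' *m D) - F (p + y *m D) - (y' - y) = - (T y' - T y).
    by rewrite /T; apply/rowP => j; rewrite !mxE; ring.
  rewrite normrN => /le_trans; apply.
  apply: (@le_trans _ _ (((C + 1) * 2)^-1 * (`|y' - y| * (C + 1)))).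
    apply: ler_wpM2l; first exact: ltW.
    apply: le_trans (norm_mulmx_le _ _) _.
    by rewrite ler_wpM2l // lerDl.
  by rewrite le_eqVlt; apply/orP; left; apply/eqP; field; rewrite gt_eqF.
have T0 : `|T 0| = `|F p| by rewrite /T mul0mx addr0 sub0r normrN.
have U0 : U 0 by apply/UP; rewrite normr0.
(* [|T y| <= |T 0| + |y| / 2 <= |F p| + r / 2 = r], whence the choice [r = 2 |F p|]. *)
have TU : {homo T : y / U y >-> U y}.
  move=> y Uy; apply/UP; rewrite -[T y](subrK (T 0)).
  apply: le_trans (ler_normD _ _) _; rewrite T0.
  have := Tlip _ _ U0 Uy; rewrite subr0; move/UP : Uy; rewrite /r; lra.
have ctr : is_contraction (mkfun_fun TU).
  exists (2^-1)%:nng; split => /=; first by rewrite invf_lt1 // ltr1n.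
  by move=> [y y'] [/= Uy Uy']; exact: Tlip.
have [|y Uy yE] := banach_fixed_point ctr (@closed_closed_ball_ _ _ _ _).
  by exists 0.
exists (p + y *m D).
  have {}yE : y = T y := yE.
  by apply/eqP; rewrite -oppr_eq0 -(inj_eq (addrI y)) addr0 eq_sym {1}yE.
rewrite addrAC subrr add0r; apply: le_trans (norm_mulmx_le _ _) _; rewrite -/C.
by move/UP : Uy => /(ler_wpM2r C0)/le_trans; apply; rewrite /r mulrC mulrA.
Unshelve. all: by end_near. Qed.

(** Along a curve in [N] both [F (g h)] and [F x] vanish, so strict differentiability bounds the
    difference quotients by [|q h J| <= e |q h|]. In the limit [|v J| <= e |v|] for every
    [e > 0]. *)
Lemma tangent_jacobian0 (R : realType) (L m : nat) (N U : set 'rV[R]_L)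
    (F : 'rV[R]_L -> 'rV[R]_m) (x v : 'rV[R]_L) :
  Ck 1 F -> open U -> U x -> (forall y, U y -> (N y <-> F y = 0)) ->
  tangent N x v -> v *m Defs.jacobian F x = 0.
Proof.
move=> CF oU Ux NF [g [g0 [gN [dg gv]]]].
set J := Defs.jacobian F x.
have gc : g h @[h --> (0 : R)] --> x.
  by rewrite -g0; apply/differentiable_continuous/derivable1_diffP.
have gU : \forall h \near (0 : R), U (g h) by apply: gc; exact: open_nbhs_nbhs.
have Fx : F x = 0.
  by apply/(NF _ Ux); rewrite -g0; exact: nbhs_singleton gN.
pose q h := h^-1 *: (g h - x).
have qv : q h @[h --> 0^'] --> v.
  have E : (fun h => h^-1 *: ((g \o shift 0) (h *: (1:R)) - g 0)) = q.
    by apply/funext => h; rewrite /= [_ *: 1]mulr1 addr0 g0.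
  by move: dg gv; rewrite /derivable /derive E => qc <-; exact: qc.
have qJ e : 0 < e -> \forall h \near 0^', `|q h *m J| <= e * `|q h|.
  move=> e0; have [d d0 dP] := Ck1_strict_diff x CF e0.
  have gd : \forall h \near (0 : R), `|x - g h| < d.
    by move/cvgrPdist_lt : gc; apply.
  apply: nbhs_dnbhs; near=> h.
  have gh : F (g h) = 0 by apply/NF; near: h.
  have : `|g h - x| < d by rewrite distrC; near: h.
  rewrite /q -scalemxAl !normrZ => ghx; rewrite mulrCA ler_wpM2l //.
  have := dP x (g h); rewrite subrr normr0 => /(_ d0 ghx).
  by rewrite gh Fx subrr sub0r normrN.
have qJv : q h *m J @[h --> 0^'] --> v *m J.
  apply/cvgrPdist_le => e e0.
  pose C := L%:R * `|J| + 1.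
  have C0 : 0 < C by rewrite ltr_wpDl // mulr_ge0.
  move/cvgrPdist_le : qv => /(_ (e / C)); rewrite divr_gt0 // => /(_ isT).
  apply: filterS => h; rewrite ler_pdivlMr // => /(le_trans _); apply.
  rewrite -mulmxBl; apply: le_trans (norm_mulmx_le _ _) _.
  by rewrite ler_wpM2l // lerDl.
have le e : 0 < e -> `|v *m J| <= e * `|v|.
  move=> e0; apply: (@ler_cvg_to _ 0^' _ _ (fun h => `|q h *m J|)
    (fun h => e * `|q h|) _ _ (cvg_norm qJv) _ (qJ _ e0)).
  by apply: cvgM; [exact: cvg_cst|exact: cvg_norm].
apply/eqP; rewrite -normr_le0; apply/ler_addgt0Pl => e e0; rewrite addr0.
have v0 : 0 < `|v| + 1 by rewrite ltr_wpDl.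
apply: le_trans (le (e / (`|v| + 1)) _) _; first by rewrite divr_gt0.
by rewrite mulrAC ler_pdivrMr // ler_pM2l // lerDl.
Unshelve. all: by end_near. Qed.

(** The line [x + h v] is moved onto the zero set by [near_zero_regular]. As [v J = 0],
    [F (x + h v)] is [o(h)], hence so is the displacement, and the velocity at 0 is still [v]. A
    tangent curve need only be derivable at 0, so the points can be chosen separately for each
    [h]. *)
Lemma jacobian0_tangent (R : realType) (L m : nat) (N U : set 'rV[R]_L)
    (F : 'rV[R]_L -> 'rV[R]_m) (x v : 'rV[R]_L) :
  Ck 1 F -> open U -> U x -> (forall y, U y -> (N y <-> F y = 0)) -> N x ->
  \rank (Defs.jacobian F x) = m ->
  v *m Defs.jacobian F x = 0 -> tangent N x v.
Proof.
move=> CF oU Ux NF Nx rJ vJ.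
have Fx : F x = 0 by apply/(NF _ Ux).
have [c c0 cP] := near_zero_regular CF Fx rJ.
pose l (h : R) : 'rV[R]_L := x + h *: v.
pose A (h : R) := [set z : 'rV[R]_L |
  F z = 0 /\ `|z - (x + h *: v)| <= c * `|F (x + h *: v)|].
(* The default [x] is returned only where [A h] is empty, which does not happen near 0. *)
pose g (h : R) := xget x (A h).
have line : l h @[h --> (0 : R)] --> x.
  rewrite /l.
  rewrite -[X in _ --> X](addr0 x) -[in X in _ --> X](scale0r v).
  apply: cvgD; first exact: cvg_cst.
  by apply: cvgZ; [exact: cvg_id|exact: cvg_cst].
have gA : \forall h \near (0 : R), A h (g h).
  have ln : \forall h \near (0 : R),
      exists2 z, F z = 0 & `|z - l h| <= c * `|F (l h)| by exact: (line _ cP).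
  apply: filterS ln => h [z Fz zle].
  by apply: (@xgetPex _ x (A h)); exists z.
(* At [h = 0] the bound [c * |F x| = 0] leaves no other choice. *)
have g0 : g 0 = x.
  have [_] := nbhs_singleton gA.
  by rewrite scale0r addr0 Fx normr0 mulr0 normr_le0 subr_eq0 => /eqP.
have qv : h^-1 *: (g h - x) @[h --> 0^'] --> v.
  apply/cvgrPdist_le => e e0.
  (* Chosen so that tolerance [e / C] for [F] gives an error at most [c * (e / C) * |v| <= e] in the
     quotient. *)
  pose C := c * `|v| + 1.
  have C0 : 0 < C by rewrite ltr_wpDl // mulr_ge0.
  have eC : 0 < e / C by rewrite divr_gt0.
  have [d d0 dP] := Ck1_strict_diff x CF eC.
  have ld : \forall h \near (0 : R), `|x - (x + h *: v)| < d.
    by move/cvgrPdist_lt : line; apply.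
  have gA' := nbhs_dnbhs gA; have ld' := nbhs_dnbhs ld.
  near=> h.
  have h0 : h != 0 by near: h; exact: nbhs_dnbhs_neq.
  have [_ ghle] : A h (g h) by near: h.
  have hd : `|x + h *: v - x| < d by rewrite distrC; near: h.
  have := dP x (x + h *: v); rewrite subrr normr0 => /(_ d0 hd).
  have -> : x + h *: v - x = h *: v by rewrite addrC addKr.
  rewrite Fx subr0 -scalemxAl vJ scaler0 subr0 normrZ => Fle.
  have -> : v - h^-1 *: (g h - x) = - (h^-1 *: (g h - (x + h *: v))).
    by rewrite opprD addrA [in RHS]scalerBr opprB scalerA mulVf // scale1r.
  rewrite normrN normrZ normfV ler_pdivrMl ?normr_gt0 //.
  apply: le_trans ghle _; apply: le_trans (ler_wpM2l c0 Fle) _.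
  have -> : c * (e / C * (`|h| * `|v|)) = `|h| * (e * ((c * `|v|) / C)).
    by field; rewrite gt_eqF.
  rewrite ler_wpM2l // ler_piMr ?(ltW e0) // ler_pdivrMr // mul1r lerDl //.
have E : (fun h => h^-1 *: ((g \o shift 0) (h *: (1:R)) - g 0)) =
    (fun h => h^-1 *: (g h - x)).
  by apply/funext => h; rewrite /= [_ *: 1]mulr1 addr0 g0.
have dg : derivable g 0 1 by rewrite /derivable E; apply/cvg_ex; exists v.
exists g; split => //; split; last first.
  by split => //; rewrite /derive E; exact: cvg_lim.
(* Continuity at 0 keeps [g h] in [U], where zeros of [F] are points of [N]. *)
have gc : g h @[h --> (0 : R)] --> x.
  by rewrite -g0; apply/differentiable_continuous/derivable1_diffP.
have gU : \forall h \near (0 : R), U (g h) by apply: gc; exact: open_nbhs_nbhs.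
near=> h; apply/NF; first by near: h.
have [//] : A h (g h) by near: h.
Unshelve. all: by end_near. Qed.

(** * The Grassmannian bundle is Borel *)

Lemma cvg_mx (R : realType) (T : Type) (G : set_system T) {FG : Filter G}
    (m n : nat) (f : T -> 'M[R]_(m, n)) (l : 'M[R]_(m, n)) :
  (forall i j, f x i j @[x --> G] --> l i j) -> f x @[x --> G] --> l.
Proof.
move=> fl; apply/cvgrPdist_le => e e0.
have : \forall x \near G, forall ij : 'I_m * 'I_n,
    `|l ij.1 ij.2 - f x ij.1 ij.2| <= e.
  apply: (@filter_forall _ _ (fun ij x => `|l ij.1 ij.2 - f x ij.1 ij.2| <= e)).
  by move=> [i j]; have /cvgrPdist_le := fl i j; exact.
apply: filterS => x fx; apply: norm_mx_le (ltW e0) _ => i j.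
by have := fx (i, j); rewrite !mxE.
Qed.

Lemma cvg_coef (R : realType) (T : Type) (G : set_system T) {FG : Filter G}
    (m n : nat) (f : T -> 'M[R]_(m, n)) (l : 'M[R]_(m, n)) i j :
  f x @[x --> G] --> l -> f x i j @[x --> G] --> l i j.
Proof.
by move=> fl; exact: (cvg_comp _ _ fl (@coord_continuous _ _ _ i j l)).
Qed.

Lemma cvg_sumr (R : realType) (T : Type) (G : set_system T) {FG : Filter G}
    (n : nat) (f : 'I_n -> T -> R) (l : 'I_n -> R) :
  (forall i, f i x @[x --> G] --> l i) ->
  \sum_(i < n) f i x @[x --> G] --> \sum_(i < n) l i.
Proof. by move=> fl; apply: cvg_big => // [z]; exact: add_continuous. Qed.

Lemma cvg_mulmx (R : realType) (T : Type) (G : set_system T) {FG : Filter G}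
    (m n p : nat) (f : T -> 'M[R]_(m, n)) (g : T -> 'M[R]_(n, p))
    (a : 'M[R]_(m, n)) (b : 'M[R]_(n, p)) :
  f x @[x --> G] --> a -> g x @[x --> G] --> b ->
  f x *m g x @[x --> G] --> a *m b.
Proof.
move=> fa gb; apply: cvg_mx => i j.
rewrite mxE; under eq_fun do rewrite mxE.
by apply: cvg_sumr => k; apply: cvgM; exact: cvg_coef.
Qed.

Lemma cvg_lsubmx (R : realType) (T : Type) (G : set_system T) {FG : Filter G}
    (m n p : nat) (f : T -> 'M[R]_(m, n + p)) (a : 'M[R]_(m, n + p)) :
  f x @[x --> G] --> a -> lsubmx (f x) @[x --> G] --> lsubmx a.
Proof.
move=> fa; apply: cvg_mx => i j; rewrite mxE; under eq_fun do rewrite mxE.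
exact: cvg_coef.
Qed.

(** If [f p] were nonzero, [f] would be nonzero near [p], against the points of [A] there. Vanishing
    is asked only near [p] because defining functions of [N] are local. *)
Lemma closure_cvg_eq0 (R : realType) (T : topologicalType) (V : normedModType R)
    (A : set T) (f : T -> V) (p : T) :
  closure A p -> f x @[x --> p] --> f p ->
  (\forall x \near p, A x -> f x = 0) -> f p = 0.
Proof.
move=> Ap fp Af; apply/eqP/negPn/negP => fp0.
have : \forall x \near p, (A x -> f x = 0) /\ `|f p - f x| < `|f p|.
  near=> x; split; first by near: x.
  by near: x; move/cvgrPdist_lt : fp; apply; rewrite normr_gt0.
move=> /Ap[x [Ax [/(_ Ax) -> ]]].
by rewrite subr0 ltxx.
Unshelve. all: by end_near. Qed.

(** * Tangent planes of the product and closedness of the bundle *)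

Lemma tangent_lsubmx (R : realType) (L s : nat) (N : set 'rV[R]_L)
    (z w : 'rV[R]_(L + s)) :
  tangent (@prodZ R L s N) z w -> tangent N (lsubmx z) (lsubmx w).
Proof.
move=> [g [g0 [gN [dg gw]]]].
have dgi i j : derivable (fun t => g t i j) 0 1 by have /derivable_mxP := dg; apply.
have E i j : (fun t => (lsubmx (g t)) i j) = (fun t => g t i (lshift s j)).
  by apply/funext => t; rewrite mxE.
have dl : derivable (fun t => lsubmx (g t)) 0 1.
  by apply/derivable_mxP => i j; rewrite E.
exists (fun t => lsubmx (g t)); split; first by rewrite g0.
split; last first.
  split => //; rewrite derive_mx // -gw derive_mx //.
  by apply/matrixP => i j; rewrite !mxE E.
apply: filterS gN => t [x [y [Nx ->]]].
by rewrite row_mxKl.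
Qed.

(** The curve in [N] is paired with a straight line in the unconstrained factor [R^s]. *)
Lemma tangent_prodZ (R : realType) (L s : nat) (N : set 'rV[R]_L)
    (z w : 'rV[R]_(L + s)) :
  tangent N (lsubmx z) (lsubmx w) -> tangent (@prodZ R L s N) z w.
Proof.
move=> [g [g0 [gN [dg gw]]]].
pose f (t : R) : 'rV[R]_(L + s) := row_mx (g t) (rsubmx z + t *: rsubmx w).
have fd i j : is_derive (0 : R) (1 : R) (fun t => f t i j) (w i j).
  rewrite (ord1 i) {i}; have [k jk|k jk] := splitP j.
    have -> : j = lshift s k by exact: val_inj.
    have -> : (fun t => f t 0 (lshift s k)) = (fun t => g t 0 k).
      by apply/funext => t; rewrite /f row_mxEl.
    split; first by have /derivable_mxP := dg; apply.
    by have /matrixP/(_ 0 k) := gw; rewrite derive_mx // !mxE.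
  have -> : j = rshift L k by exact: val_inj.
  have -> : (fun t => f t 0 (rshift L k)) =
      cst (z 0 (rshift L k)) + w 0 (rshift L k) \*: id.
    by apply/funext => t; rewrite /f row_mxEr !mxE [in RHS]/GRing.add /= mulrC.
  by apply: is_derive_eq; rewrite add0r [_ *: 1]mulr1.
have df : derivable f 0 1 by apply/derivable_mxP => i j; exact: ex_derive.
exists f; split; first by rewrite /f g0 scale0r addr0 hsubmxK.
split; first by apply: filterS gN => t Nt; exists (g t), (rsubmx z + t *: rsubmx w).
split => //; rewrite derive_mx //; apply/matrixP => i j; rewrite mxE.
exact: derive_val.
Qed.

(** Turns tangency of a plane into a matrix equation that depends continuously on [(z, P)] and that
    bounds traces. *)
Lemma tangent_prodZ_planeP (R : realType) (L s m : nat) (N U : set 'rV[R]_L)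
    (F : 'rV[R]_L -> 'rV[R]_m) (z : 'rV[R]_(L + s)) (P : 'M[R]_(L + s)) :
  Ck 1 F -> open U -> U (lsubmx z) -> (forall y, U y -> (N y <-> F y = 0)) ->
  N (lsubmx z) -> \rank (Defs.jacobian F (lsubmx z)) = m ->
  (forall v, tangent (@prodZ R L s N) z (v *m P)) <->
  lsubmx P *m Defs.jacobian F (lsubmx z) = 0.
Proof.
move=> CF oU Uz NF Nz rJ; split=> [tP|PJ v].
  apply/row_matrixP => i; rewrite row0 rowE mulmxA mulmx_lsub.
  exact: (tangent_jacobian0 CF oU Uz NF (tangent_lsubmx (tP _))).
apply: tangent_prodZ; apply: (jacobian0_tangent CF oU Uz NF Nz rJ).
by rewrite -mulmx_lsub -mulmxA PJ mulmx0.
Qed.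

Lemma jacobian_cvg (R : realType) (M m : nat) (F : 'rV[R]_M -> 'rV[R]_m)
    (x : 'rV[R]_M) :
  Ck 1 F -> Defs.jacobian F y @[y --> x] --> Defs.jacobian F x.
Proof.
move=> [_ CF]; apply: (@cvg_mx _ _ (nbhs x)) => l i.
rewrite mxE; under eq_fun do rewrite mxE.
by apply: cvg_coef; have [_] := CF l; exact.
Qed.

(** Apart from membership in the compact [K], each defining condition is recast as the vanishing of
    a function continuous at the limit point. *)
Lemma Grass_closed (R : realType) (L n s j : nat) (N : set 'rV[R]_L)
    (K : set 'rV[R]_(L + s)) :
  submanifold n N -> K `<=` @prodZ R L s N -> compact K ->
  closed (Grass (@prodZ R L s N) j K).
Proof.
move=> [nL hN] KZ cK [z P] clG.
have Kcl : closed K by apply: compact_closed => //; exact: norm_hausdorff.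
have c1 : xP.1 @[xP --> (z, P)] --> z by exact: cvg_fst.
have c2 : xP.2 @[xP --> (z, P)] --> P by exact: cvg_snd.
have Kz : K z.
  apply: Kcl => B zB; have /clG[xP [GxP BxP]] : nbhs (z, P) (fst @^-1` B).
    exact: c1.
  by exists xP.1; split => //; case: GxP.
have [x [y [Nx zE]]] := KZ _ Kz.
have {zE}Nz : N (lsubmx z) by rewrite zE row_mxKl.
have [U [oU [Uz [F [sF [NF rJ]]]]]] := hN _ Nz.
have CF := sF 1%N.
have PT : P^T = P.
  apply/eqP; rewrite -subr_eq0; apply/eqP.
  apply: (closure_cvg_eq0
    (f := fun xP : GSpace R (L + s) => xP.2^T - xP.2) clG).
    apply: cvgB => //; apply: cvg_mx => a b /=; rewrite mxE.
    by under eq_fun do rewrite mxE; exact: cvg_coef.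
  by near=> xP => -[_ [-> _]]; rewrite subrr.
have PP : P *m P = P.
  apply/eqP; rewrite -subr_eq0; apply/eqP.
  apply: (closure_cvg_eq0
    (f := fun xP : GSpace R (L + s) => xP.2 *m xP.2 - xP.2) clG).
    by apply: cvgB => //; exact: cvg_mulmx.
  by near=> xP => -[_ [_ [-> _]]]; rewrite subrr.
(* The rank is not continuous, but on idempotents it equals the trace, which is. *)
have trP : \tr P = j%:R.
  apply/eqP; rewrite -subr_eq0; apply/eqP.
  apply: (closure_cvg_eq0
    (f := fun xP : GSpace R (L + s) => \tr xP.2 - j%:R : R^o) clG).
    apply: cvgB; last exact: cvg_cst.
    by apply: cvg_sumr => i; exact: cvg_coef.
  near=> xP => -[_ [_ [PP' [rP _]]]].
  by rewrite mxtrace_idem // rP subrr.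
split => //; split => //; split => //; split.
  by apply/eqP; rewrite -(eqr_nat R) -mxtrace_idem // trP.
(* The defining function [F] chosen at the limit point also serves at all nearby points of the
   bundle. *)
apply/(tangent_prodZ_planeP (F := F) _ CF oU Uz NF Nz (rJ _ Uz Nz)).
have c1l : lsubmx xP.1 @[xP --> (z, P)] --> lsubmx z by exact: cvg_lsubmx.
apply: (closure_cvg_eq0 (f := fun xP : GSpace R (L + s) =>
  lsubmx xP.2 *m Defs.jacobian F (lsubmx xP.1)) clG).
  apply: cvg_mulmx; first exact: cvg_lsubmx.
  exact: (cvg_comp _ _ c1l (jacobian_cvg CF)).
have Unear : \forall xP \near (z, P), U (lsubmx xP.1).
  by apply: c1l; exact: open_nbhs_nbhs.
near=> xP => -[KxP [_ [_ [_ tP]]]].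
have UxP : U (lsubmx xP.1) by near: xP.
have NxP : N (lsubmx xP.1).
  by have [x' [y' [Nx' ->]]] := KZ _ KxP; rewrite row_mxKl.
exact/(tangent_prodZ_planeP _ CF oU UxP NF NxP (rJ _ UxP NxP)).
Unshelve. all: by end_near. Qed.

Lemma closed_measurable_GBorel (R : realType) (M : nat) (A : set (GSpace R M)) :
  closed A -> measurable (A : set (GBorel R M)).
Proof.
move=> cA; rewrite -(setCK A); apply: measurableC.
by apply: sub_sigma_algebra; exact: closed_openC.
Qed.

Lemma continuous_measurable_GBorel (R : realType) (M : nat)
    (f : GSpace R M -> R) :
  continuous f -> measurable_fun setT (f : GBorel R M -> R).
Proof.
move=> cf; apply: (measurability _ (@RGenOpens.measurableE R)).
move=> _ [_ [a [b ->] <-]]; rewrite setTI.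
apply: sub_sigma_algebra.
by apply: open_comp.
Qed.

(** * The vertical vector field *)

Section cutoff.
Variable R : realType.
Implicit Types r t h : R.

(** Squaring the positive part makes it [C^1], the regularity asked of test fields. *)
Definition sqramp t : R := Num.max 0 t ^+ 2.

(** The quadratic bound also covers sign changes between [t] and [t + h], so the derivative at 0 is
    no special case. *)
Lemma sqramp_taylor t h :
  `|sqramp (t + h) - sqramp t - 2 * Num.max 0 t * h| <= h ^+ 2.
Proof.
rewrite /sqramp ler_norml !maxEle.
by case: ifPn => [?|]; case: ifPn => [?|]; rewrite -?ltNge => *;
  apply/andP; split; nra.
Qed.

Lemma is_derive_sqramp t : is_derive t (1 : R) sqramp (2 * Num.max 0 t).
Proof.
suff cv : h^-1 *: ((sqramp \o shift t) (h *: (1 : R)) - sqramp t) @[h --> 0^']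
    --> 2 * Num.max 0 t.
  by split; [apply/cvg_ex; exists (2 * Num.max 0 t)|exact: cvg_lim].
apply/cvgrPdist_le => e e0; near=> h.
have h0 : h != 0 by near: h; exact: nbhs_dnbhs_neq.
have he : `|h| < e by near: h; exact: dnbhs0_lt.
have := sqramp_taylor t h; rewrite /= [_ *: 1]mulr1 (addrC h).
set a := sqramp _; set b := sqramp _; set c := 2 * _ => ab.
rewrite /GRing.scale /= distrC.
have -> : h^-1 * (a - b) - c = h^-1 * (a - b - c * h) by field.
rewrite normrM normfV ler_pdivrMl ?normr_gt0 //.
apply: le_trans ab _; rewrite -(ger0_norm (sqr_ge0 h)) normrX expr2.
by rewrite ler_wpM2l // ltW.
Unshelve. all: by end_near. Qed.

(** The inner ramp leaves 0 at [t = r] and reaches 1 at [t = r + 1]; the outer one truncates at 0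
    from there on. *)
Definition cutoff r t : R := sqramp (1 - sqramp (t - r)).

Definition dcutoff r t : R :=
  2 * Num.max 0 (1 - sqramp (t - r)) * - (2 * Num.max 0 (t - r)).

Lemma is_derive_cutoff r t : is_derive t (1 : R) (cutoff r) (dcutoff r t).
Proof.
have d1 : is_derive t (1 : R) (fun x => sqramp (x - r)) (2 * Num.max 0 (t - r)).
  have := @is_derive1_comp R sqramp (shift (- r)) t _ _ (is_derive_sqramp _)
    (is_derive_shift t 1 (- r)).
  by move=> H; apply: is_derive_eq H _; rewrite mulr1.
have d2 : is_derive t (1 : R) (fun x => 1 - sqramp (x - r))
    (- (2 * Num.max 0 (t - r))).
  have := is_deriveB (is_derive_cst (1 : R) t (1 : R)) d1.
  by move=> H; apply: is_derive_eq H _; rewrite sub0r.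
by have := @is_derive1_comp R sqramp _ t _ _ (is_derive_sqramp _) d2; apply.
Qed.

Lemma cutoff1 r t : t <= r -> cutoff r t = 1.
Proof.
move=> tr; rewrite /cutoff /sqramp (max_l (y := t - r)) ?subr_le0 //.
by rewrite expr0n subr0 max_r // expr1n.
Qed.

Lemma dcutoff0 r t : t <= r -> dcutoff r t = 0.
Proof.
move=> tr; rewrite /dcutoff (max_l (y := t - r)) ?subr_le0 //.
by rewrite mulr0 oppr0 mulr0.
Qed.

Lemma cutoff0 r t : r + 1 <= t -> cutoff r t = 0.
Proof.
move=> rt; rewrite /cutoff {1}/sqramp max_l ?expr0n // subr_le0 /sqramp.
rewrite max_r; last by lra.
by rewrite expr_ge1 //; lra.
Qed.

Lemma cutoff_continuous r : continuous (cutoff r).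
Proof.
move=> t; apply/differentiable_continuous/derivable1_diffP.
by have := is_derive_cutoff r t.
Qed.

Lemma max0_continuous : continuous (fun t : R => Num.max 0 t).
Proof. by move=> t; apply: continuous_max; [exact: cvg_cst|exact: cvg_id]. Qed.

Lemma dcutoff_continuous r : continuous (dcutoff r).
Proof.
have sc : continuous sqramp.
  move=> t; apply/differentiable_continuous/derivable1_diffP.
  by have := is_derive_sqramp t.
have tr t : x - r @[x --> t] --> t - r by apply: cvgB; [exact: cvg_id|exact: cvg_cst].
move=> t; apply: (@cvgM _ _ (nbhs t)).
  apply: cvgM; first exact: cvg_cst.
  have c : 1 - sqramp (x - r) @[x --> t] --> 1 - sqramp (t - r).
    apply: cvgB; first exact: cvg_cst.
    exact: (cvg_comp _ _ (tr t) (sc _)).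
  exact: (cvg_comp _ _ c (@max0_continuous _)).
apply: cvgN; apply: cvgM; first exact: cvg_cst.
exact: (cvg_comp _ _ (tr t) (@max0_continuous _)).
Qed.

End cutoff.

(** * Directional derivatives by restriction to lines *)

Lemma line_is_derive (R : realType) (V W : normedModType R) (f : V -> W)
    (x v : V) (df : W) :
  is_derive (0 : R) (1 : R) (fun t => f (x + t *: v)) df -> is_derive x v f df.
Proof.
have E : (fun h => h^-1 *: (((fun t => f (x + t *: v)) \o shift 0) (h *: (1:R))
            - f (x + 0 *: v))) =
         (fun h => h^-1 *: ((f \o shift x) (h *: v) - f x)).
  apply/funext => h /=; rewrite [_ *: 1]mulr1 addr0 scale0r addr0.
  by rewrite [h *: v + x]addrC.
by case; rewrite /derivable /derive E => dv dE; split.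
Qed.

Lemma is_derive_comp1 (R : realType) (V : normedModType R) (f : R -> R)
    (g : V -> R) (x v : V) (df dg : R) :
  is_derive (g x) (1 : R) f df -> is_derive x v g dg ->
  is_derive x v (fun y => f (g y)) (df * dg).
Proof.
move=> Hf Hg; apply: line_is_derive.
have g0 : is_derive (0 : R) (1 : R) (fun t => g (x + t *: v)) dg.
  by apply: is_derive_line; rewrite scale0r addr0.
have := @is_derive1_comp R f (fun t => g (x + t *: v)) 0 df dg.
by rewrite scale0r addr0; apply.
Qed.

Lemma is_derive_coef (R : realType) (m n : nat) (x v : 'M[R]_(m, n)) i j :
  is_derive x v (fun y : 'M[R]_(m, n) => y i j) (v i j).
Proof.
have [d dE] := is_derive_id x v.
split; first by have /derivable_mxP := d; apply.
by have /matrixP/(_ i j) := dE; rewrite derive_mx // mxE.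
Qed.

(** The Euclidean square replaces the sup norm of row vectors, which is not differentiable
    everywhere. *)
Definition sqnorm (R : realType) (M : nat) (z : 'rV[R]_M) : R :=
  \sum_(i < M) z 0 i ^+ 2.

Lemma is_derive_sqnorm (R : realType) (M : nat) (z v : 'rV[R]_M) :
  is_derive z v (@sqnorm R M) (\sum_(i < M) 2 * z 0 i * v 0 i).
Proof.
have dX (i : 'I_M) : is_derive z v (fun y : 'rV[R]_M => y 0 i ^+ 2) (2 * z 0 i * v 0 i).
  have := is_deriveX 2 (is_derive_coef z v 0 i).
  by move=> H; apply: is_derive_eq H _; rewrite /= expr1.
have := is_derive_sum dX.
have -> // : (\sum_(i < M) (fun y : 'rV[R]_M => y 0 i ^+ 2)) = @sqnorm R M.
by apply/funext => y; rewrite fct_sumE.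
Qed.

Lemma cvg_sqnorm (R : realType) (M : nat) (z : 'rV[R]_M) :
  sqnorm y @[y --> z] --> sqnorm z.
Proof.
apply: (@cvg_sumr _ _ (nbhs z)) => i.
by apply: cvgM; apply: cvg_coef; exact: cvg_id.
Qed.

Section vertical_field.
Variables (R : realType) (L s : nat) (r : R).
Local Notation E := 'rV[R]_(L + s).

(** The factor [(L <= i)%:R] selects the coordinates of [R^s]. *)
Definition vertical_field (z : E) : E :=
  \row_i (cutoff r (sqnorm z) * ((L <= i)%:R * z 0 i)).

Definition pder_vertical_field (l : 'I_(L + s)) (z : E) : E :=
  \row_i (cutoff r (sqnorm z) * ((L <= i)%:R * (i == l)%:R) +
          (L <= i)%:R * z 0 i * (dcutoff r (sqnorm z) * (2 * z 0 l))).

Lemma is_derive_vertical_field_coef (l i : 'I_(L + s)) (z : E) :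
  is_derive z (ebasis R l) (fun y => vertical_field y 0 i)
    (pder_vertical_field l z 0 i).
Proof.
have dn : is_derive z (ebasis R l) (@sqnorm R (L + s)) (2 * z 0 l).
  have H := is_derive_sqnorm z (ebasis R l); apply: is_derive_eq H _.
  rewrite (bigD1 l) //= big1 ?addr0 => [|k kl]; first by rewrite mxE !eqxx mulr1.
  by rewrite mxE (negbTE kl) andbF mulr0.
have dc := is_derive_comp1 (is_derive_cutoff r (sqnorm z)) dn.
have dz : is_derive z (ebasis R l) (fun y : E => (L <= i)%:R * y 0 i)
    ((L <= i)%:R * (i == l)%:R).
  have H := is_deriveZ (L <= i)%:R (is_derive_coef z (ebasis R l) 0 i).
  by apply: is_derive_eq H _; rewrite mxE eqxx.
have H := is_deriveM dc dz.
have -> : (fun y => vertical_field y 0 i) =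
    (fun y => cutoff r (sqnorm y)) * (fun y : E => (L <= i)%:R * y 0 i).
  by apply/funext => y; rewrite mxE.
by apply: is_derive_eq H _; rewrite mxE.
Qed.

Lemma derivable_vertical_field (l : 'I_(L + s)) (z : E) :
  derivable vertical_field z (ebasis R l).
Proof.
apply/derivable_mxP => i j; rewrite (ord1 i).
by have [] := is_derive_vertical_field_coef l j z.
Qed.

Lemma pder_vertical_fieldE (l : 'I_(L + s)) :
  pder vertical_field l = pder_vertical_field l.
Proof.
apply/funext => z; apply/rowP => i.
rewrite pder_coef; last exact: derivable_vertical_field.
by have [] := is_derive_vertical_field_coef l i z.
Qed.

Lemma vertical_field_Ck1 : Ck 1 vertical_field.
Proof.
have cs (z : E) : cutoff r (sqnorm y) @[y --> z] --> cutoff r (sqnorm z).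
  exact: (cvg_comp _ _ (@cvg_sqnorm _ _ z) (@cutoff_continuous _ r _)).
have ds (z : E) : dcutoff r (sqnorm y) @[y --> z] --> dcutoff r (sqnorm z).
  exact: (cvg_comp _ _ (@cvg_sqnorm _ _ z) (@dcutoff_continuous _ r _)).
have cz (z : E) i : y 0 i @[y --> z] --> z 0 i by exact: coord_continuous.
have cc (z : E) (c : R) : (fun y : E => c) @ nbhs z --> c.
  exact: (@cvg_cst _ c _ (nbhs z) _).
split=> [z|l].
  apply: (@cvg_mx _ _ (nbhs z)) => i j; rewrite (ord1 i) mxE.
  under eq_fun do rewrite mxE.
  exact: (cvgM (cs z) (cvgM (cc z _) (cz z j))).
split => [z|]; first exact: derivable_vertical_field.
rewrite pder_vertical_fieldE => z.
apply: (@cvg_mx _ _ (nbhs z)) => i j; rewrite (ord1 i) mxE.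
under eq_fun do rewrite mxE.
exact: (cvgD (cvgM (cs z) (cc z _))
  (cvgM (cvgM (cc z _) (cz z j)) (cvgM (ds z) (cvgM (cc z _) (cz z l))))).
Qed.

Lemma vertical_field_support :
  0 <= r -> exists C : set E, compact C /\ forall z, ~ C z -> vertical_field z = 0.
Proof.
(* Outside this cube some coordinate has [z_i^2 >= (r + 1)^2 >= r + 1], so the cutoff vanishes. *)
move=> r0; exists [set z : E | forall i, `[- (r + 1), r + 1]%classic (z ord0 i)].
split.
  by apply: (@rV_compact _ _ (fun=> `[- (r + 1), r + 1]%classic)) => _;
    exact: segment_compact.
move=> z /existsNP[i zi]; apply/rowP => k; rewrite !mxE cutoff0 ?mul0r //.
have zr : r + 1 <= z 0 i ^+ 2.
  rewrite leNgt; apply/negP => lt; apply: zi; rewrite /= in_itv /=.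
  by apply/andP; split; nra.
apply: le_trans zr _; rewrite /sqnorm (bigD1 i) //= lerDl.
by apply: sumr_ge0 => j _; exact: sqr_ge0.
Qed.

(** The [R^L]-component is zero, so a constant curve serves in [N]. *)
Lemma vertical_field_tangent (N : set 'rV[R]_L) (z : E) :
  @prodZ R L s N z -> tangent (@prodZ R L s N) z (vertical_field z).
Proof.
move=> [x [y [Nx zE]]]; apply: tangent_prodZ.
have -> : lsubmx (vertical_field z) = 0.
  by apply/rowP => i; rewrite !mxE /= leqNgt ltn_ord /= mul0r mulr0.
exists (cst (lsubmx z)); split => //; split.
  by near=> t; rewrite /= zE row_mxKl.
by split; [exact: derivable_cst|exact: derive_cst].
Unshelve. all: by end_near. Qed.

(** Where [sqnorm z <= r], boundary included, the cutoff is 1 with zero derivative, so the field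
    differentiates like the projection to [R^s]. *)
Lemma divP_vertical_field (P : 'M[R]_(L + s)) (z : E) :
  sqnorm z <= r -> divP P vertical_field z = \tr P - \tr (ulsubmx P).
Proof.
move=> zr; rewrite /divP.
transitivity (\sum_(i < L + s) (L <= i)%:R * P i i).
  apply: eq_bigr => i _; rewrite (bigD1 i) //= big1 ?addr0 => [|l li].
    rewrite pder_vertical_fieldE mxE cutoff1 // dcutoff0 // eqxx.
    by rewrite mul0r mulr0 addr0 mul1r mulr1 mulrC.
  rewrite pder_vertical_fieldE mxE dcutoff0 // mul0r mulr0 addr0.
  by rewrite eq_sym (negbTE li) !mulr0.
rewrite /mxtrace !big_split_ord /= big1 ?add0r => [|i _]; last first.
  by rewrite leqNgt ltn_ord mul0r.
under [X in _ = _ - X]eq_bigr do rewrite !mxE.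
rewrite addrAC subrr add0r; apply: eq_bigr => i _.
by rewrite leq_addr mul1r.
Qed.

End vertical_field.

Lemma compact_sqnorm_bounded (R : realType) (M : nat) (K : set 'rV[R]_M) :
  compact K -> exists2 r : R, 0 <= r & forall z, K z -> sqnorm z <= r.
Proof.
move=> /compact_bounded[B [Br KB]].
(* Boundedness supplies an estimate only for constants strictly above [B]. *)
pose b := `|B| + 1.
exists (M%:R * b ^+ 2); first by rewrite mulr_ge0 // sqr_ge0.
move=> z /(KB b) zb.
have {}zb : `|z| <= b by apply: zb; rewrite ltr_pwDr // ler_norm.
have le1 (i : 'I_M) : z 0 i ^+ 2 <= b ^+ 2.
  rewrite -ler_sqrt ?sqr_ge0 // !sqrtr_sqr.
  apply: le_trans (coef_le_norm z 0 i) _; apply: le_trans zb _; exact: ler_norm.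
apply: le_trans (ler_sum _ (fun i _ => le1 i)) _.
by rewrite sumr_const card_ord -[leLHS]mulr_natl.
Qed.

(** * Positivity of the first variation *)

Lemma divP_continuous (R : realType) (M : nat) (X : 'rV[R]_M -> 'rV[R]_M) :
  Ck 1 X -> continuous (fun xP : GSpace R M => divP xP.2 X xP.1).
Proof.
move=> [_ CX] p; apply: (@cvg_sumr _ _ (nbhs p)) => i.
apply: cvg_sumr => l; apply: cvgM.
  by apply: cvg_coef; exact: cvg_snd.
have [_ cX] := CX l.
have c1 : xP.1 @[xP --> p] --> p.1 by exact: cvg_fst.
by apply: cvg_coef; exact: (cvg_comp _ _ c1 (cX p.1)).
Qed.

(** Tangency of the plane becomes [lsubmx P *m J = 0], under which [mxtrace_ulsubmx_le] bounds the
    horizontal trace by [n], while [\tr P = n + k]. *)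
Lemma Grass_divP_ge (R : realType) (L n s k : nat) (N : set 'rV[R]_L)
    (K : set 'rV[R]_(L + s)) (r : R) (xP : GSpace R (L + s)) :
  submanifold n N -> K `<=` @prodZ R L s N ->
  (forall z, K z -> sqnorm z <= r) ->
  Grass (@prodZ R L s N) (n + k) K xP ->
  k%:R <= divP xP.2 (vertical_field r) xP.1.
Proof.
case: xP => z P [nL hN] KZ Kr [/= Kz [PT [PP [rP tP]]]].
have [x [y [Nx zE]]] := KZ _ Kz.
have {zE}Nz : N (lsubmx z) by rewrite zE row_mxKl.
have [U [oU [Uz [F [sF [NF rJ]]]]]] := hN _ Nz.
have rJz := rJ _ Uz Nz.
have PJ := (tangent_prodZ_planeP P (sF 1%N) oU Uz NF Nz rJz).1 tP.
have := mxtrace_ulsubmx_le nL PT PP rJz PJ.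
rewrite divP_vertical_field ?Kr // (mxtrace_idem PP) rP natrD; lra.
Qed.

(** The sign of [f] is unknown off [G], so the integral is first restricted to [G]; there
    [c * mu G <= \int f = 0]. *)
Lemma ge_on_conull_integral_eq0 (d : measure_display) (T : measurableType d)
    (R : realType) (mu : {measure set T -> \bar R}) (G : set T) (f : T -> R)
    (c : R) :
  measurable G -> mu (~` G) = 0%E -> measurable_fun setT f -> 0 < c ->
  (forall x, G x -> c <= f x) -> (\int[mu]_x (f x)%:E = 0)%E ->
  mu setT = 0%E.
Proof.
move=> mG G0 mf c0 cf f0.
have mfE : measurable_fun setT (EFin \o f) by exact/measurable_EFinP.
have muT : mu setT = mu G.
  rewrite -(setUv G) measureU ?setICr //; last exact: measurableC.
  by rewrite [X in _ + X](_ : _ = 0%E) ?adde0 // G0.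
have intG : (\int[mu]_(x in G) (f x)%:E = 0)%E.
  rewrite -f0 [LHS]integral_mkcond; apply: ae_eq_integral => //.
    by apply/(measurable_restrictT _ mG); exact: measurable_funS mfE.
  exists (~` G); split => //; first exact: measurableC.
  by move=> x /= nx Gx; apply: nx => _; rewrite patchE mem_set.
have : (c%:E * mu G <= \int[mu]_(x in G) (f x)%:E)%E.
  rewrite -integral_cst //; apply: ge0_le_integral => //.
  - by move=> x _; rewrite lee_fin ltW.
  - exact: measurable_funS mfE.
rewrite intG muT pmule_rle0 ?lte_fin // => le0.
by apply/eqP; rewrite eq_le le0 measure_ge0.
Qed.

Unset Implicit Arguments.

Theorem theorem7p6 (R : realType) (L n s : nat) (N : set 'rV[R]_L)
  (hN : submanifold n N) (hs : (1 < s)%N)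
  (K : set 'rV[R]_(L + s)) (hKZ : K `<=` @prodZ R L s N) (hK : compact K)
  (k : nat) (hk1 : (1 <= k)%N) (hk2 : (k <= s - 1)%N)
  (V : {measure set (GBorel R (L + s)) -> \bar R}) :
  varifold (@prodZ R L s N) (n + k) K V -> stationary (@prodZ R L s N) V ->
  V setT = 0%E.
Proof.
move=> [_ VG] statV.
have [r r0 Kr] := compact_sqnorm_bounded hK.
(* With [r] bounding [sqnorm] on [K], the cutoff equals 1 on all of [K]. *)
have tX : tangent_field (@prodZ R L s N) (@vertical_field R L s r).
  split; first exact: vertical_field_Ck1.
  by split; [exact: vertical_field_support|exact: vertical_field_tangent].
apply: (ge_on_conull_integral_eq0 (c := k%:R) _ VG _ _ _ (statV _ tX)).
- apply: (@closed_measurable_GBorel R (L + s)); exact: (Grass_closed hN).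
- apply: (@continuous_measurable_GBorel R (L + s)); apply: divP_continuous.
  exact: vertical_field_Ck1.
(* Here [k >= 1] makes the lower bound strictly positive. *)
- by rewrite ltr0n.
- by move=> xP; exact: Grass_divP_ge.
Qed.
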